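(* Let $P$ be an integral convex polygon in $\mathbb{R}^2$ given by its edge sequence $\{n_ie_i\}_{1\le i\le m}$ starting at a vertex $v_0$, with $e_i\in\mathbb{Z}^2$ primitive. Let $IP$ be the set of integral points of $P$. Consider the following algorithm: (1) compute $IP$ and set $A_0=\emptyset$; (2) for $i=1,\dots,m-1$, let $A_i$ consist of all points $v_0+ke_i\in IP$ with $0<k\le n_i$, together with all points $u+ke_i\in IP$ with $u\in A_{i-1}$ and $0\le k\le n_i$; (3) let $A_m$ consist of all points $u+ke_m\in IP$ with $u\in A_{m-1}$ and $0\le k<n_m$; (4) return ''Indecomposable'' if $v_0\notin A_m$ and ''Decomposable'' otherwise. Then this algorithm correctly decides whether $P$ is integrally decomposable, and it uses $O(tmN)$ vector operations, where $t$ is the number of integral points in $P$, $m$ is the number of edges of $P$, and $N$ is the maximum number of integral points on an edge of $P$.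
   Context: An integral polytope is a convex polytope whose vertices have integer coordinates. An integral polytope is (integrally) decomposable if it is the Minkowski sum $A+B=\{a+b:a\in A,b\in B\}$ of two integral polytopes $A,B$ each having more than one point. For an integral convex polygon $P$ with vertices $v_0,\dots,v_{m-1}$ in clockwise order, the edge vectors are $E_i=v_i-v_{i-1}\in\mathbb{Z}^2$ (indices mod $m$); writing $E_i=n_ie_i$ with $n_i$ the gcd of the coordinates of $E_i$ and $e_i$ a primitive vector (coprime integer coordinates), $\{n_ie_i\}_{1\le i\le m}$ is the edge sequence of $P$. A vector operation means adding two vectors, multiplying a vector by a scalar, or adjoining a point to a set. *)

(* Defs.v *)
From mathcomp Require Import all_boot all_order all_algebra.
From mathcomp Require Import finmap.
From mathcomp Require Import boolp classical_sets cardinality reals.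

Set Implicit Arguments.
Unset Strict Implicit.
Unset Printing Implicit Defensive.

Import Order.TTheory GRing.Theory Num.Theory.
Local Open Scope classical_set_scope.
Local Open Scope ring_scope.

(** * Integral polytopes *)

Definition conv_hull (R : realType) (n : nat) (s : seq 'rV[R]_n) : set 'rV[R]_n :=
  [set x | exists w : 'I_(size s) -> R,
     [/\ forall i, 0 <= w i, \sum_i w i = 1 & x = \sum_i w i *: s`_i]].

Definition convex_polytope (R : realType) (n : nat) (P : set 'rV[R]_n) : Prop :=
  exists s : seq 'rV[R]_n, P = conv_hull s.

Definition vertex (R : realType) (n : nat) (P : set 'rV[R]_n) (x : 'rV[R]_n) : Prop :=
  P x /\ forall (y z : 'rV[R]_n) (a : R),
    P y -> P z -> 0 < a < 1 -> x = a *: y + (1 - a) *: z -> y = x /\ z = x.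

Definition toR (R : realType) (n : nat) (z : 'rV[int]_n) : 'rV[R]_n :=
  map_mx intr z.
Arguments toR R {n} z.

Definition integral_polytope (R : realType) (n : nat) (P : set 'rV[R]_n) : Prop :=
  convex_polytope P /\
  forall x, vertex P x -> exists z : 'rV[int]_n, x = toR R z.

Definition minkowski_sum (R : realType) (n : nat) (A B : set 'rV[R]_n) :
    set 'rV[R]_n :=
  [set a + b | a in A & b in B].

Definition more_than_one_point (T : Type) (A : set T) : Prop :=
  exists x y, [/\ A x, A y & x <> y].

Definition decomposable (R : realType) (n : nat) (P : set 'rV[R]_n) : Prop :=
  exists A B : set 'rV[R]_n,
    [/\ integral_polytope A, integral_polytope B,
        more_than_one_point A, more_than_one_point B &
        P = minkowski_sum A B].

Definition integral_points (R : realType) (n : nat) (A : set 'rV[R]_n) :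
    set 'rV[int]_n :=
  [set z | A (toR R z)].

(* [fset_set] is only meaningful on finite sets; the arguments below are bounded
   polytopes, which have finitely many integral points. *)
Definition nb_integral_points (R : realType) (n : nat) (A : set 'rV[R]_n) : nat :=
  #|` fset_set (integral_points A)|.

(** * Polygons and edge sequences *)

Definition cross (R : pzRingType) (u v : 'rV[R]_2) : R :=
  u 0 0 * v 0 1 - u 0 1 * v 0 0.

(* Indices are read modulo the number of vertices. *)
Definition cyc (v : seq 'rV[int]_2) (i : nat) : 'rV[int]_2 := v`_(i %% size v).

(* Clockwise: walking from a vertex to the next one, the polygon lies on the
   right. A polygon is two-dimensional, i.e. has at least three vertices. *)
Definition integral_polygon (R : realType) (P : set 'rV[R]_2)
    (v : seq 'rV[int]_2) : Prop :=
  [/\ integral_polytope P,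
      (2 < size v)%N,
      uniq v,
      forall x, vertex P x <-> exists2 z, z \in v & x = toR R z &
      forall (i : nat) (x : 'rV[R]_2), P x ->
        cross (toR R (cyc v i.+1) - toR R (cyc v i)) (x - toR R (cyc v i)) <= 0].

Definition max_edge_points (R : realType) (v : seq 'rV[int]_2) : nat :=
  \max_(i < size v)
     nb_integral_points (conv_hull [:: toR R (cyc v i); toR R (cyc v i.+1)]).

(* The entry [(n, e)] stands for the vector [n e]; the entry of index [i]
   (counted from 0) is the edge from [v_i] to [v_(i+1)]. *)
Definition edge_sequence (v : seq 'rV[int]_2) (es : seq (nat * 'rV[int]_2)) : Prop :=
  size es = size v /\
  forall i, (i < size v)%N ->
    let E := cyc v i.+1 - cyc v i in
    let: (n, e) := nth (0%N, 0) es i in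
    [/\ E = n%:Z *: e,
        n = gcdn `|E 0 0| `|E 0 1| &
        coprime `|e 0 0| `|e 0 1|].

(** * Programs that count vector operations *)

(* The first component is the number of vector operations performed; arithmetic
   on scalars and membership tests are not vector operations. *)
Definition counted (T : Type) : Type := (nat * T)%type.

Definition ret (T : Type) (x : T) : counted T := (0%N, x).

Definition bind (T U : Type) (c : counted T) (f : T -> counted U) : counted U :=
  ((c.1 + (f c.2).1)%N, (f c.2).2).

Notation "'let!' x ':=' c 'in' d" := (bind c (fun x => d))
  (at level 200, x name, c at level 100, d at level 200).

Fixpoint for_each (I T : Type) (s : seq I) (body : I -> T -> counted T) (a : T) :
    counted T :=
  if s is i :: s' then let! b := body i a in for_each s' body b else ret a.

Definition vadd (u v : 'rV[int]_2) : counted 'rV[int]_2 := (1%N, u + v).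

Definition vscale (k : int) (u : 'rV[int]_2) : counted 'rV[int]_2 := (1%N, k *: u).

Definition adjoin (u : 'rV[int]_2) (A : {fset 'rV[int]_2}) :
    counted {fset 'rV[int]_2} :=
  (1%N, (u |` A)%fset).

(** * The algorithm *)

Inductive answer : Set := Indecomposable | Decomposable.

(* The edges with their starting points, computed from the edge sequence. *)
Fixpoint located_edges (v : 'rV[int]_2) (es : seq (nat * 'rV[int]_2)) :
    counted (seq ('rV[int]_2 * 'rV[int]_2)) :=
  if es is (n, e) :: es' then
    let! E := vscale n%:Z e in
    let! v' := vadd v E in
    let! l := located_edges v' es' in
    ret ((v, e) :: l)
  else ret [::].

(* [cross l.2 (z - l.1) <= 0], spelled out on coordinates so that only scalar
   arithmetic is involved. *)
Definition right_of (l : 'rV[int]_2 * 'rV[int]_2) (z : 'rV[int]_2) : bool :=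
  l.2 0 0 * (z 0 1 - l.1 0 1) - l.2 0 1 * (z 0 0 - l.1 0 0) <= 0.

(* The polygon lies in the square of centre [v0] and half-side [radius es]. *)
Definition radius (es : seq (nat * 'rV[int]_2)) : nat :=
  (\sum_(E <- es) E.1 * maxn `|E.2 0%R 0%R| `|E.2 0%R 1%R|)%N.

Definition box (v0 : 'rV[int]_2) (r : nat) : seq 'rV[int]_2 :=
  [seq \row_(c < 2) (v0 0 c - r%:Z + (if c == 0 then i else j)%:Z)
     | i <- iota 0 r.*2.+1, j <- iota 0 r.*2.+1].

(* All the integral points lying on the right of every edge. *)
Definition compute_IP (v0 : 'rV[int]_2) (es : seq (nat * 'rV[int]_2)) :
    counted {fset 'rV[int]_2} :=
  let! l := located_edges v0 es in
  for_each (box v0 (radius es))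
    (fun z IP => if all (right_of^~ z) l then adjoin z IP else ret IP) fset0.

(* Adjoin [u + k e] to [A] if it belongs to [IP]. *)
Definition try_adjoin (IP : {fset 'rV[int]_2}) (u e : 'rV[int]_2) (k : nat)
    (A : {fset 'rV[int]_2}) : counted {fset 'rV[int]_2} :=
  let! ke := vscale k%:Z e in
  let! p := vadd u ke in
  if p \in IP then adjoin p A else ret A.

(* From [A_(i-1)] to [A_i], for [i < m]. *)
Definition middle_step (IP : {fset 'rV[int]_2}) (v0 : 'rV[int]_2)
    (ne : nat * 'rV[int]_2) (A : {fset 'rV[int]_2}) : counted {fset 'rV[int]_2} :=
  let: (n, e) := ne in
  let! B := for_each (iota 1 n) (try_adjoin IP v0 e) fset0 in
  for_each (enum_fset A)
    (fun u => for_each (iota 0 n.+1) (try_adjoin IP u e)) B.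

(* From [A_(m-1)] to [A_m]. *)
Definition last_step (IP : {fset 'rV[int]_2})
    (ne : nat * 'rV[int]_2) (A : {fset 'rV[int]_2}) : counted {fset 'rV[int]_2} :=
  let: (n, e) := ne in
  for_each (enum_fset A)
    (fun u => for_each (iota 0 n) (try_adjoin IP u e)) fset0.

Definition polydecomp (v0 : 'rV[int]_2) (es : seq (nat * 'rV[int]_2)) :
    counted answer :=
  let m := size es in
  let! IP := compute_IP v0 es in
  let! A := for_each (take m.-1 es) (middle_step IP v0) fset0 in
  let! Am := last_step IP (nth (0%N, 0) es m.-1) A in
  ret (if v0 \in Am then Decomposable else Indecomposable).

(* Main.v *)
Require Import Defs.
From mathcomp Require Import all_boot all_order all_algebra.
From mathcomp Require Import finmap.
From mathcomp Require Import boolp classical_sets cardinality reals.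
From mathcomp Require Import zify ring lra.

(** The half-planes on the right of the edges cut out exactly [P], by a fan of
    triangles at a vertex; hence [IP] is the set of integral points of [P].

    [P] is decomposable iff there are integers [0 <= k_i <= n_i], neither all [0]
    nor all [n_i], with [sum_i k_i e_i = 0].  If [P = A + B], each vertex splits
    uniquely as [v_i = a_i + b_i] with [a_i], [b_i] vertices of [A], [B], and
    [a_(i+1) - a_i] is a multiple [k_i e_i] of the edge direction; the points
    [a_i + b_0] are then a walk inside [P] which the algorithm can follow.
    Conversely the partial sums [a_i] of such a closed walk, and [b_i = v_i - a_i],
    turn in the same direction as the boundary of [P], so they stay on the right
    of lines parallel to the edges, and [P] is the sum of their hulls.

    The cost is dominated by the [m] steps, each trying at most [N] multiples
    from at most [t] points. *)

Set Implicit Arguments.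
Unset Strict Implicit.
Unset Printing Implicit Defensive.

(** * Vectors and convex hulls *)

Section Cross.
Import GRing.Theory.
Local Open Scope ring_scope.

Lemma row2P (T : Type) (u w : 'rV[T]_2) : u 0 0 = w 0 0 -> u 0 1 = w 0 1 -> u = w.
Proof.
move=> h0 h1; apply/matrixP => i j; rewrite (ord1 i).
by case: (unliftP 0 j) => [k ->|->//]; rewrite (ord1 k) (_ : lift _ _ = 1) //; apply: val_inj.
Qed.

Variable K : comPzRingType.
Implicit Types (u w x y : 'rV[K]_2) (a : K).

Lemma crossC u w : cross u w = - cross w u.
Proof. by rewrite /cross; ring. Qed.

Lemma crossxx u : cross u u = 0.
Proof. by rewrite /cross; ring. Qed.

Lemma crossDr u x y : cross u (x + y) = cross u x + cross u y.
Proof. by rewrite /cross !mxE; ring. Qed.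

Lemma crossBr u x y : cross u (x - y) = cross u x - cross u y.
Proof. by rewrite /cross !mxE; ring. Qed.

Lemma crossZr u a x : cross u (a *: x) = a * cross u x.
Proof. by rewrite /cross !mxE; ring. Qed.

Lemma crossZl u a x : cross (a *: u) x = a * cross u x.
Proof. by rewrite /cross !mxE; ring. Qed.

Lemma cramer u w x : cross u w *: x = cross x w *: u + cross u x *: w.
Proof. by apply: row2P; rewrite /cross !mxE; ring. Qed.

End Cross.

Section PrimitiveVectors.
Import GRing.Theory.
Local Open Scope ring_scope.

(** The multiplier is the combination of the coordinates of [u] with Bezout coefficients of [e],
    hence an integer. *)
Lemma primitive_parallel (e u : 'rV[int]_2) :
  coprime `|e 0 0| `|e 0 1| -> cross e u = 0 -> exists k : int, u = k *: e.
Proof.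
move=> co; rewrite /cross => /eqP; rewrite subr_eq0 => /eqP eu.
have /coprimezP[[x y] /= xy] : coprimez (e 0 0) (e 0 1) by [].
exists (x * u 0 0 + y * u 0 1); apply: row2P; rewrite !mxE mulrDl.
- by rewrite -[LHS]mul1r -xy mulrDl -!mulrA [u 0 1 * _]mulrC eu; ring.
- by rewrite -[LHS]mul1r -xy mulrDl -!mulrA [u 0 0 * _]mulrC -eu; ring.
Qed.

Lemma primitive_neq0 (e : 'rV[int]_2) : coprime `|e 0 0| `|e 0 1| -> e != 0.
Proof. by move=> co; apply/eqP => e0; move: co; rewrite e0 !mxE. Qed.

End PrimitiveVectors.

Section ToR.
Import GRing.Theory.
Local Open Scope ring_scope.
Variable R : realType.

Lemma toRD n (x y : 'rV[int]_n) : toR R (x + y) = toR R x + toR R y.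
Proof. exact: map_mxD. Qed.

Lemma toRB n (x y : 'rV[int]_n) : toR R (x - y) = toR R x - toR R y.
Proof. exact: map_mxB. Qed.

Lemma toRZ n (k : int) (x : 'rV[int]_n) : toR R (k *: x) = k%:~R *: toR R x.
Proof. exact: map_mxZ. Qed.

Lemma toR_inj n : injective (@toR R n).
Proof.
move=> x y /matrixP xy; apply/matrixP => i j; have := xy i j.
by rewrite !mxE => /intr_inj.
Qed.

Lemma cross_toR (x y : 'rV[int]_2) : cross (toR R x) (toR R y) = (cross x y)%:~R.
Proof. by rewrite /cross !mxE rmorphB !rmorphM. Qed.

End ToR.

(** * Convex combinations, linear bounds and vertices of hulls *)

Section ConvexHull.
Import Order.TTheory GRing.Theory Num.Theory.
Local Open Scope classical_set_scope.
Local Open Scope ring_scope.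
Variables (R : realType) (n : nat).
Implicit Types (s t : seq 'rV[R]_n) (x y : 'rV[R]_n).

(** Weights indexed by [nat] can be given as [nth] of an explicit list, or shared by hulls of
    several lists of equal length. *)
Lemma conv_hullP s x : conv_hull s x <-> exists w : nat -> R,
  [/\ forall i, 0 <= w i, \sum_(i < size s) w i = 1
    & x = \sum_(i < size s) w i *: s`_i].
Proof.
split=> [[w [w0 w1 ->]]|[w [w0 w1 ->]]]; last by exists (fun i => w i).
exists (fun i => if insub i is Some j then w j else 0); split.
- by move=> i; case: insub.
- by rewrite -w1; apply: eq_bigr => i _; rewrite valK.
- by apply: eq_bigr => i _; rewrite valK.
Qed.

Lemma conv_hull_nth s i : (i < size s)%N -> conv_hull s s`_i.
Proof.
move=> lti; apply/conv_hullP; exists (fun j => (j == i)%:R); split=> //.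
- by rewrite (bigD1 (Ordinal lti)) //= eqxx big1 ?addr0 // => j; rewrite -val_eqE /= => /negbTE ->.
- rewrite (bigD1 (Ordinal lti)) //= eqxx scale1r big1 ?addr0 // => j.
  by rewrite -val_eqE /= => /negbTE ->; rewrite scale0r.
Qed.

Lemma conv_hull_sub s t :
  (forall i, (i < size t)%N -> conv_hull s t`_i) -> conv_hull t `<=` conv_hull s.
Proof.
move=> ts x [w [w0 w1 ->]].
have /choice [g gP] : forall i : 'I_(size t), exists g : 'I_(size s) -> R,
    [/\ forall j, 0 <= g j, \sum_j g j = 1 & t`_i = \sum_j g j *: s`_j].
  by move=> i; have [g gP] := ts i (ltn_ord i); exists g.
exists (fun j => \sum_i w i * g i j); split.
- move=> j; apply: sumr_ge0 => i _; apply: mulr_ge0 => //.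
  by have [+ _ _] := gP i; apply.
- rewrite exchange_big -[RHS]w1; apply: eq_bigr => i _.
  by have [_ g1 _] := gP i; rewrite -mulr_sumr g1 mulr1.
- under [RHS]eq_bigr do rewrite scaler_suml.
  rewrite exchange_big; apply: eq_bigr => i _; have [_ _ ->] := gP i.
  by rewrite scaler_sumr; apply: eq_bigr => j _; rewrite scalerA.
Qed.

Lemma conv_hull_le s (f : 'rV[R]_n -> R) (c : R) :
  (forall x y, f (x + y) = f x + f y) -> (forall a x, f (a *: x) = a * f x) ->
  (forall i, (i < size s)%N -> f s`_i <= c) -> forall x, conv_hull s x -> f x <= c.
Proof.
move=> fD fZ fs x [w [w0 w1 ->]].
have f0 : f 0 = 0 by rewrite -(scale0r 0) fZ mul0r.
rewrite (big_morph f fD f0) -[c]mul1r -w1 mulr_suml.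
by apply: ler_sum => i _; rewrite fZ; apply: ler_wpM2l => //; exact: fs.
Qed.

(** Pick a weight [w i > 0]. Either it is 1 and [x] is the [i]-th generator, or [x] lies strictly
    between this generator and a barycentre [y] of the others, and extremality makes them equal. *)
Lemma vertex_conv_hull s x : vertex (conv_hull s) x -> x \in s.
Proof.
case=> [[w [w0 w1 xE]] ext].
have [i wi] : exists i, 0 < w i.
  apply: contrapT => /forallNP h; have : \sum_i w i = 0.
    by apply: big1 => i _; apply/eqP; rewrite eq_le w0 andbT leNgt; apply/negP; exact: h.
  by rewrite w1 => /eqP; rewrite oner_eq0.
have xs (j : 'I_(size s)) : conv_hull s s`_j by apply: conv_hull_nth.
have sumi : \sum_(j | j != i) w j = 1 - w i.
  by rewrite -w1 [in RHS](bigD1 i) //= addrC addrK.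
have [wi1|wi1] := eqVneq (w i) 1.
  have w0' j : j != i -> w j = 0.
    move=> ji; apply/eqP; rewrite eq_le w0 andbT.
    have <- : 1 - w i = 0 by rewrite wi1 subrr.
    by rewrite -sumi (bigD1 j) //= lerDl sumr_ge0.
  rewrite xE (bigD1 i) //= wi1 scale1r big1 ?addr0 ?mem_nth // => j ji.
  by rewrite w0' // scale0r.
have lt1 : w i < 1.
  rewrite lt_neqAle wi1 /= -w1 (bigD1 i) //= lerDl; exact: sumr_ge0.
have ne : 1 - w i != 0 by rewrite subr_eq0 eq_sym.
(* The remaining weights sum to [1 - w i]; dividing by it makes them convex. *)
pose y := \sum_j (if j == i then 0 else w j / (1 - w i)) *: s`_(nat_of_ord j).
have sy : conv_hull s y.
  exists (fun j => if j == i then 0 else w j / (1 - w i)); split=> //.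
  - move=> j; case: eqP => // _; apply: divr_ge0 => //.
    by rewrite subr_ge0 ltW.
  - rewrite (bigD1 i) //= eqxx add0r.
    under eq_bigr => j ji do rewrite (negbTE ji).
    by rewrite -mulr_suml sumi divff.
have xy : x = w i *: s`_i + (1 - w i) *: y.
  rewrite xE (bigD1 i) //=; congr (_ + _).
  rewrite /y [in RHS](bigD1 i) //= eqxx scale0r add0r scaler_sumr.
  apply: eq_bigr => j ji; rewrite (negbTE ji) scalerA; congr (_ *: _).
  by rewrite mulrCA mulfV // mulr1.
have [] := ext _ _ (w i) (xs i) sy _ xy; first by rewrite wi.
by move=> <- _; apply: mem_nth.
Qed.

End ConvexHull.

(** * Boundary of a convex polygon *)

Section PolygonGeometry.
Import Order.TTheory GRing.Theory Num.Theory.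
Local Open Scope classical_set_scope.
Local Open Scope ring_scope.

Lemma cross_eq0_parallel (F : fieldType) (u x : 'rV[F]_2) :
  u != 0 -> cross u x = 0 -> exists s, x = s *: u.
Proof.
move=> u0; rewrite /cross => /eqP; rewrite subr_eq0 => /eqP ux.
have [u00|u00] := eqVneq (u 0 0) 0.
- have u01 : u 0 1 != 0.
    by apply: contra_neq u0 => u01; apply: row2P; rewrite mxE.
  have x00 : x 0 0 = 0.
    by move: ux; rewrite u00 mul0r => /esym/eqP; rewrite mulf_eq0 (negbTE u01) => /eqP.
  by exists (x 0 1 / u 0 1); apply: row2P; rewrite mxE ?u00 ?x00 ?mulr0 // divfK.
- exists (x 0 0 / u 0 0); apply: row2P; rewrite mxE; first by rewrite divfK.
  by rewrite mulrAC [x 0 0 * _]mulrC -ux mulrAC divff ?mul1r.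
Qed.

(** After a positive increment [h] no longer decreases. If one occurs before [i], then [h i <= h m];
    otherwise [h] has not increased up to [i], and [h i <= h 0]. *)
Lemma valley (F : realDomainType) (h : nat -> F) (m : nat) :
  h 0%N <= 0 -> h m <= 0 ->
  (forall i j, (i < j < m)%N -> 0 < h i.+1 - h i -> 0 <= h j.+1 - h j) ->
  forall i, (i <= m)%N -> h i <= 0.
Proof.
move=> h0 hm hmono i im.
have [[j ji jh]|nup] := pselect (exists2 j, (j < i)%N & 0 < h j.+1 - h j).
  apply: le_trans hm; rewrite -subr_ge0.
  rewrite -(telescope_sumr h im) big_seq; apply: sumr_ge0 => k.
  by rewrite mem_index_iota => /andP[ik km]; apply: (hmono j) => //; lia.
apply: le_trans h0; rewrite -subr_le0 -(telescope_sumr h (leq0n i)) big_seq.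
apply: sumr_le0 => k; rewrite mem_index_iota /= => ki.
rewrite leNgt; apply/negP => hk; apply: nup.
by exists k.
Qed.

Variables (R : realType) (P : set 'rV[R]_2) (v : seq 'rV[int]_2).
Hypothesis polyP : integral_polygon P v.

Local Notation V i := (toR R (cyc v i)).
Local Notation E i := (V i.+1 - V i).
Local Notation m := (size v).

Lemma polygon_size : (2 < m)%N.
Proof. by case: polyP. Qed.

Lemma cyc_mod i : cyc v (i %% m) = cyc v i.
Proof. by rewrite /cyc modn_mod. Qed.

Lemma cycDsize i : cyc v (i + m) = cyc v i.
Proof. by rewrite /cyc modnDr. Qed.

Lemma cyc_mem i : cyc v i \in v.
Proof. by rewrite mem_nth // ltn_mod; have := polygon_size; lia. Qed.

Lemma polygon_vertex i : vertex P (V i).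
Proof. by case: polyP => _ _ _ vP _; apply/vP; exists (cyc v i) => //; exact: cyc_mem. Qed.

Lemma polygon_V i : P (V i).
Proof. by have [] := polygon_vertex i. Qed.

Lemma V_inj i j : V i = V j -> i = j %[mod m].
Proof.
case: polyP => _ _ uv _ _ /toR_inj /eqP.
have m0 : (0 < m)%N by have := polygon_size; lia.
by rewrite nth_uniq ?ltn_mod // => /eqP.
Qed.

Lemma V_neqS i : V i.+1 <> V i.
Proof.
move/V_inj; rewrite modnS; have := polygon_size.
case: ifP => [|_ _ ]; last by lia.
move=> /dvdnP[[//|k]]; rewrite mulSn => ik mgt.
have -> : i = (k * m + m.-1)%N by lia.
rewrite modnMDl modn_small; lia.
Qed.

Lemma E_neq0 i : E i != 0.
Proof. by rewrite subr_eq0; apply/eqP/V_neqS. Qed.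

Lemma polygon_right i x : P x -> cross (E i) (x - V i) <= 0.
Proof. by case: polyP => _ _ _ _; apply. Qed.

Lemma polygon_conv_hull_sub (t : seq 'rV[R]_2) :
  (forall i, (i < size t)%N -> P t`_i) -> conv_hull t `<=` P.
Proof. by case: polyP => -[[s ->] _] _ _ _ _; exact: conv_hull_sub. Qed.

(** For [s < 0] the vertex [V i], and for [s > 1] the vertex [V i.+1], would lie strictly between
    the given point and the other end of the edge, against extremality. *)
Lemma edge_line i s : P (V i + s *: E i) -> 0 <= s <= 1.
Proof.
move=> Ps; rewrite -[0 <= s]negbK -[s <= 1]negbK -!ltNge; apply/andP; split; apply/negP => h.
- have [_ ext] := polygon_vertex i.
  have s1 : 1 - s != 0 by apply/eqP; lra.
  have [||/V_neqS] := ext _ _ (- s / (1 - s)) (polygon_V i.+1) Ps => //.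
    rewrite divr_gt0 ?ltr_pdivrMr; lra.
  by apply: row2P; rewrite !mxE; field.
- have [_ ext] := polygon_vertex i.+1.
  have s0 : s != 0 by apply/eqP; lra.
  have [||_ /esym/V_neqS] := ext _ _ s^-1 Ps (polygon_V i) => //.
    rewrite invr_gt0 invf_lt1; lra.
  by apply: row2P; rewrite !mxE; field.
Qed.

(** A vertex on the line of the edge lies on the edge itself by [edge_line]; being extreme, it is
    one of the two ends. *)
Lemma strict_right i j :
  j <> i %[mod m] -> j <> i.+1 %[mod m] -> cross (E i) (V j - V i) < 0.
Proof.
move=> ji ji1; rewrite lt_neqAle (polygon_right _ (polygon_V j)) andbT.
apply/eqP => /(cross_eq0_parallel (E_neq0 i))[s sE].
have Vj : V j = V i + s *: E i by rewrite -sE addrC subrK.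
have := polygon_V j; rewrite {1}Vj => /edge_line /andP[s0 s1].
have [_ ext] := polygon_vertex j.
have [||_ /esym/V_inj //] := ext _ _ s (polygon_V i.+1) (polygon_V i).
- rewrite !lt_neqAle s0 s1 !andbT; apply/andP; split; apply/eqP => sE'.
    by apply: ji; apply: V_inj; rewrite Vj -sE' scale0r addr0.
  by apply: ji1; apply: V_inj; rewrite Vj sE' scale1r addrC subrK.
- by rewrite Vj; apply: row2P; rewrite !mxE; ring.
Qed.

Lemma neq_modD i d : (0 < d < m)%N -> i + d <> i %[mod m].
Proof.
by move=> dm /eqP; rewrite -[X in _ == X %[mod _]]addn0 eqn_modDl mod0n modn_small; lia.
Qed.

Lemma strict_turn i : cross (E i) (E i.+1) < 0.
Proof.
have -> : E i.+1 = (V i.+2 - V i) - E i by rewrite opprB addrA subrK.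
have mgt := polygon_size.
rewrite crossBr crossxx subr0 strict_right //.
- by have := @neq_modD i 2; rewrite addn2; apply; lia.
- by have := @neq_modD i.+1 1; rewrite addn1; apply; lia.
Qed.

(* Once the walk along the boundary comes closer to the line of the edge [l],
   it does so until it is back: a local minimum of the distance is global,
   because the polygon lies in the cone spanned at a vertex by its two edges. *)
Lemma approach_step l i :
  (i.+1 < m)%N -> 0 < cross (E l) (E (l + i)) -> 0 < cross (E l) (E (l + i.+1)).
Proof.
case: i => [|i im]; first by rewrite addn0 crossxx ltxx.
rewrite (addnS l i.+1); set j := (l + i.+1)%N => cj; rewrite ltNge; apply/negP => cj1.
pose X := V l - V j.+1.
have lX : 0 < cross (E l) X.
  have -> : X = -1 *: (V j.+1 - V l) by rewrite scaleN1r opprB.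
  rewrite crossZr mulN1r oppr_gt0 strict_right // /j.
  - rewrite -addnS; apply: neq_modD; lia.
  - by rewrite addnS -addSn -addnS; apply: neq_modD; lia.
have wX : cross (E j.+1) X <= 0 by apply: polygon_right; apply: polygon_V.
have uX : cross (E j) X <= 0.
  have -> : X = (V l - V j) - E j by rewrite opprB addrA subrK.
  rewrite crossBr crossxx subr0; apply: polygon_right; apply: polygon_V.
(* Cramer's rule expands [X] in [E j] and [E j.+1]. After applying [cross (E l)], the left side is
   negative by [strict_turn], while the right side is a sum of two nonnegative products. *)
clearbody X; have := congr1 (cross (E l)) (cramer (E j) (E j.+1) X).
rewrite crossZr (crossDr (E l)) !(crossZr (E l)) (crossC X) => eqX.
have := strict_turn j; rewrite -(pmulr_llt0 _ lX) eqX ltNge => /negP; apply.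
by apply: addr_ge0; [apply: mulr_ge0; rewrite ?oppr_ge0 // ltW | apply: mulr_le0].
Qed.

Lemma approach l i j :
  (i < j < m)%N -> 0 < cross (E l) (E (l + i)) -> 0 < cross (E l) (E (l + j)).
Proof.
move=> /andP[ij jm] ci; elim: j ij jm => // j IHj ij jm.
apply: approach_step => //; move: ij; rewrite ltnS leq_eqVlt => /orP[/eqP <- //|ij].
apply: IHj => //; lia.
Qed.

Lemma periodic_mod (T : Type) (a : nat -> T) :
  (forall i, a (i + m)%N = a i) -> forall i, a (i %% m)%N = a i.
Proof.
move=> am i; rewrite [in RHS](divn_eq i m) addnC.
by elim: (i %/ m)%N => [|k IHk]; rewrite ?addn0 // mulSn addnCA addnC am IHk.
Qed.

(** Up to a positive factor, [h d] is the signed distance to the line through [a l] parallel to the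
    edge [l]. Its increments are [kap (l + d) * cross (E l) (E (l + d))]; by [approach] they satisfy
    the hypothesis of [valley], and [h] vanishes at both ends of the period. *)
Lemma walk_right (a : nat -> 'rV[R]_2) (kap : nat -> R) :
  (forall i, a i.+1 - a i = kap i *: E i) -> (forall i, 0 <= kap i) ->
  (forall i, a (i + m)%N = a i) ->
  forall l i, cross (E l) (a i - a l) <= 0.
Proof.
move=> aE kap0 am l i; have mgt := polygon_size.
(* Adding [l * m] makes the subtraction of [l] exact in [nat]; the index becomes [l + d] with
   [d < m]. *)
have -> : a i = a (l + (i + l * m - l) %% m)%N.
  rewrite -(periodic_mod am (l + _)) modnDmr subnKC; last by nia.
  by rewrite addnC modnMDl periodic_mod.
pose h d := cross (E l) (a (l + d)%N - a l).
have hS d : h d.+1 - h d = kap (l + d)%N * cross (E l) (E (l + d)).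
  by rewrite /h -crossBr opprB addrA subrK addnS aE crossZr.
apply: (@valley _ h m); rewrite /h ?am ?addn0 ?subrr.
- by rewrite /cross !mxE !mulr0 subrr.
- by rewrite /cross !mxE !mulr0 subrr.
- move=> d d' dd'; rewrite -/(h _) -/(h _) -/(h _) -/(h _) !hS => hd; apply: mulr_ge0 => //.
  apply/ltW/(approach dd'); have := kap0 (l + d)%N; rewrite le_eqVlt => /orP[/eqP k0|k0].
    by rewrite -k0 mul0r ltxx in hd.
  by rewrite pmulr_rgt0 in hd.
- by rewrite ltnW // ltn_mod; lia.
Qed.

(* The fan of triangles at [V 0] covers the intersection of the half-planes. *)
Lemma halfplanes_conv_hull x :
  (forall i, (i < m)%N -> cross (E i) (x - V i) <= 0) ->
  conv_hull (mkseq (fun i => V i) m) x.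
Proof.
move=> xR; have mgt := polygon_size.
pose g i := cross (V i - V 0) (x - V 0).
have Vm : V m = V 0 by rewrite /cyc modnn mod0n.
have g1 : g 1 <= 0 by apply: xR; lia.
have gm : 0 <= g m.-2.+1.
  have := xR m.-1 ltac:(lia); rewrite prednK ?Vm; last by lia.
  rewrite (_ : m.-2.+1 = m.-1); last by lia.
  by rewrite /g /cross !mxE; lra.
(* The least such [i] has [g i <= 0 <= g i.+1]: [x] lies in the angle at [V 0] of the triangle
   [V 0], [V i], [V i.+1]. *)
have gex : exists i, (1 <= i)%N && (0 <= g i.+1).
  by exists m.-2; rewrite gm andbT; lia.
case: (ex_minnP gex) => i /andP[i1 gi1] imin.
have im : (i <= m.-2)%N by apply: imin; rewrite gm andbT; lia.
have gi : g i <= 0.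
  have [->//|ine] := eqVneq i 1%N.
  rewrite leNgt; apply/negP => gi; have := imin i.-1.
  rewrite prednK // (ltW gi) andbT => /(_ ltac:(lia)); lia.
have D0 : cross (E i) (V 0 - V i) < 0.
  apply: strict_right; rewrite mod0n modn_small; lia.
pose D := cross (V i - V 0) (V i.+1 - V 0).
have DE : cross (E i) (V 0 - V i) = D by rewrite /D /cross !mxE; ring.
rewrite {}DE in D0; have Dn0 : D != 0 by rewrite lt_eqF.
have xi : cross (E i) (x - V i) <= 0 by apply: xR; lia.
have sub : conv_hull [:: V 0; V i; V i.+1] `<=` conv_hull (mkseq (fun i => V i) m).
  have inm j : (j < m)%N -> conv_hull (mkseq (fun i => V i) m) (V j).
    move=> jm; rewrite -[X in conv_hull _ X](@nth_mkseq _ 0 (fun i => V i) m) //.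
    by apply: conv_hull_nth; rewrite size_mkseq.
  by apply: conv_hull_sub => -[|[|[|//]]] _ /=; apply: inm; lia.
apply/sub/conv_hullP.
(* Barycentric coordinates of [x] in the triangle: quotients of nonpositive signed areas by the
   negative area [D], all doubled. *)
exists (nth 0 [:: cross (E i) (x - V i) / D; - g i.+1 / D; g i / D]); split.
- have neg y : y <= 0 -> 0 <= y / D by move=> y0; rewrite mulr_le0 // invr_le0 ltW.
  by case=> [|[|[|[|j]]]] //=; apply: neg => //; rewrite oppr_le0.
- rewrite !big_ord_recl big_ord0 /=; rewrite addr0 -!mulrDl.
  by apply: (canLR (mulfK Dn0)); rewrite mul1r /g /D /cross !mxE; ring.
- rewrite !big_ord_recl big_ord0 /= addr0.
  apply: (scalerI Dn0); rewrite !scalerDr !scalerA.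
  rewrite ![D * (_ / D)]mulrCA divff // !mulr1.
  by apply: row2P; rewrite /g /D /cross !mxE; ring.
Qed.

Lemma polygon_conv_hullE : P = conv_hull (mkseq (fun i => V i) m).
Proof.
apply/seteqP; split => x.
  by move=> Px; apply: halfplanes_conv_hull => i _; exact: polygon_right.
apply: polygon_conv_hull_sub => i; rewrite size_mkseq => im.
by rewrite nth_mkseq //; exact: polygon_V.
Qed.

Lemma polygon_halfplanes x :
  P x <-> forall i, (i < m)%N -> cross (E i) (x - V i) <= 0.
Proof.
split=> [Px i _|xR]; first exact: polygon_right.
by rewrite polygon_conv_hullE; exact: halfplanes_conv_hull.
Qed.

(** The edges sum to 0, so the nonpositive numbers [cross (E i) x] sum to 0 and all vanish; [E 0]
    and [E 1] are independent. *)
Lemma polygon_normals (x : 'rV[R]_2) :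
  (forall i, (i < m)%N -> cross (E i) x <= 0) -> x = 0.
Proof.
move=> xR; have mgt := polygon_size.
have sum0 : \sum_(0 <= i < m) - cross (E i) x = 0.
  have crossNE i : - cross (E i) x = cross x (V i.+1) - cross x (V i).
    by rewrite -crossC crossBr.
  under eq_bigr do rewrite crossNE.
  rewrite (telescope_sumr (fun i => cross x (V i))) // /cyc modnn mod0n subrr //.
have E0 i : (i < m)%N -> cross (E i) x = 0.
  move=> im; move: sum0; rewrite big_mkord => /eqP; rewrite psumr_eq0; last first.
    by move=> j _; rewrite oppr_ge0 xR.
  by move=> /allP /(_ (Ordinal im)); rewrite mem_index_enum /= oppr_eq0 => /(_ isT) /eqP.
have := cramer (E 0) (E 1) x; rewrite (crossC x) !E0 ?oppr0 ?scale0r ?addr0; try lia.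
move=> /eqP; rewrite scaler_eq0 => /orP[/eqP e|/eqP //].
by have := strict_turn 0; rewrite e ltxx.
Qed.

End PolygonGeometry.

(** * Decompositions and closed walks *)

Section Decomposition.
Import Order.TTheory GRing.Theory Num.Theory.
Local Open Scope classical_set_scope.
Local Open Scope ring_scope.

Lemma integral_conv_hull (R : realType) (f : nat -> 'rV[int]_2) (m : nat) :
  integral_polytope (conv_hull (mkseq (fun i => toR R (f i)) m)).
Proof.
split; first by eexists.
by move=> x /vertex_conv_hull /mapP[i _ ->]; exists (f i).
Qed.

Lemma minkowski_sumC (R : realType) n (A B : set 'rV[R]_n) :
  minkowski_sum A B = minkowski_sum B A.
Proof.
by apply/seteqP; split=> _ [a Aa [b Bb <-]]; exists b => //; exists a => //; rewrite addrC.
Qed.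

Lemma minkowski_vertexl (R : realType) n (A B : set 'rV[R]_n) a b :
  A a -> B b -> vertex (minkowski_sum A B) (a + b) -> vertex A a.
Proof.
move=> Aa Bb [_ ext]; split=> // y z t Ay Az t01 aE.
have inAB u : A u -> minkowski_sum A B (u + b) by move=> Au; exists u => //; exists b.
have [|/addIr -> /addIr ->//] := ext _ _ t (inAB y Ay) (inAB z Az) t01.
by rewrite aE !scalerDr addrACA -scalerDl addrCA subrr addr0 scale1r.
Qed.

Variables (R : realType) (P : set 'rV[R]_2) (v : seq 'rV[int]_2).
Variable es : seq (nat * 'rV[int]_2).
Hypothesis polyP : integral_polygon P v.
Hypothesis edgesP : edge_sequence v es.

Local Notation V i := (toR R (cyc v i)).
Local Notation E i := (V i.+1 - V i).
Local Notation m := (size v).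
Local Notation n i := (nth (0%N, 0) es (i %% m)).1.
Local Notation e i := (nth (0%N, 0) es (i %% m)).2.

Lemma modm_lt i : (i %% m < m)%N.
Proof. by rewrite ltn_mod; have := polygon_size polyP; lia. Qed.

Lemma edgeE i : cyc v i.+1 = cyc v i + (n i)%:Z *: e i.
Proof.
have [_ /(_ _ (modm_lt i))] := edgesP.
case: (nth _ _ _) => k u /= [+ _ _].
rewrite cyc_mod (_ : cyc v _.+1 = cyc v i.+1) => [<-|]; first by rewrite addrC subrK.
by rewrite /cyc -[(i %% m).+1]addn1 modnDml addn1.
Qed.

Lemma edge_coprime i : coprime `|e i 0 0| `|e i 0 1|.
Proof. by have [_ /(_ _ (modm_lt i))] := edgesP; case: (nth _ _ _) => k u /= []. Qed.

Lemma edge_neq0 i : e i != 0.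
Proof. exact/primitive_neq0/edge_coprime. Qed.

Lemma edge_gt0 i : (0 < n i)%N.
Proof.
rewrite lt0n; apply/eqP => n0; apply: (@V_neqS _ _ _ polyP i).
by rewrite edgeE n0 scale0r addr0.
Qed.

Lemma toR_edgeE i : E i = (n i)%:R *: toR R (e i).
Proof. by rewrite -toRB edgeE addrC addKr toRZ. Qed.

Lemma toR_primitiveE (k : int) i :
  toR R (k *: e i) = (k%:~R / (n i)%:R) *: E i.
Proof.
have n0 : (n i)%:R != 0 :> R by rewrite pnatr_eq0 -lt0n edge_gt0.
by rewrite toR_edgeE toRZ scalerA divfK.
Qed.

Lemma edge_range (k : int) i : P (V i + toR R (k *: e i)) -> 0 <= k <= n i.
Proof.
have n0 : 0 < (n i)%:R :> R by rewrite ltr0n edge_gt0.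
rewrite toR_primitiveE => /(edge_line polyP).
rewrite ler_pdivlMr // mul0r ler_pdivrMr // mul1r ler0z.
by rewrite -[(n i)%:R]/((n i)%:Z%:~R) ler_int.
Qed.

(** By [walk_right], [a l] and [b l] maximize [cross (E l)] on their hulls, and the maxima add up to
    the value at [V l]; so the sum of the hulls satisfies every half-plane of [P]. Conversely a
    convex combination of the [V i] splits with the same weights. *)
Lemma walk_decomposable (k : nat -> nat) :
  (forall i, (i < m)%N -> (k i <= n i)%N) ->
  \sum_(i < m) (k i)%:Z *: e i = 0 ->
  (exists2 i, (i < m)%N & (0 < k i)%N) -> (exists2 i, (i < m)%N & (k i < n i)%N) ->
  decomposable P.
Proof.
move=> kn k0 kpos klt; have mgt := polygon_size polyP.
(* Summing up to [i %% m] makes [a] periodic; that the full sum is 0 makes the step at the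
   wrap-around fit. *)
pose F j := (k j)%:Z *: e j; pose a i := \sum_(j < i %% m) F j.
pose b i := cyc v i - a i.
have aS i : a i.+1 = a i + (k (i %% m)%N)%:Z *: e i.
  have -> : (k (i %% m)%N)%:Z *: e i = F (i %% m)%N by rewrite /F modn_mod.
  have {}k0 M : M = m -> \sum_(j < M) F j = 0 by move->.
  have := modm_lt i; rewrite /a -[i.+1]addn1 -(modnDml i) addn1.
  move: (i %% m)%N => {}i; rewrite leq_eqVlt => /orP[/eqP im|im].
    by have := k0 _ im; rewrite big_ord_recr /= im modnn big_ord0 => ->.
  by rewrite (modn_small im) big_ord_recr.
have am i : a (i + m)%N = a i by rewrite /a modnDr.
have bm i : b (i + m)%N = b i by rewrite /b am cycDsize.
pose kap i := (k (i %% m)%N)%:R / (n i)%:R : R.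
have ngt0 i : 0 < (n i)%:R :> R by rewrite ltr0n edge_gt0.
have kap0 i : 0 <= kap i by rewrite divr_ge0.
have kap1 i : kap i <= 1.
  rewrite ler_pdivrMr // mul1r ler_nat.
  by have := kn _ (modm_lt i); rewrite modn_mod.
have aE i : toR R (a i.+1) - toR R (a i) = kap i *: E i.
  by rewrite aS toRD addrC addKr toR_primitiveE.
have bE i : toR R (b i.+1) - toR R (b i) = (1 - kap i) *: E i.
  rewrite /b !toRB scalerBl scale1r -aE !opprB addrACA [RHS]addrACA.
  by congr (_ + _); exact: addrC.
pose hull f := conv_hull (mkseq (fun i => toR R (f i : 'rV[int]_2)) m).
have hull_mem f i : (forall j, f (j + m)%N = f j) -> hull f (toR R (f i)).
  move=> fm; rewrite -(periodic_mod fm).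
  rewrite -[toR R _](@nth_mkseq _ 0 (fun i => toR R (f i)) m) ?modm_lt //.
  by apply: conv_hull_nth; rewrite size_mkseq modm_lt.
have hull_right f l x : (forall i, cross (E l) (toR R (f i) - toR R (f l)) <= 0) ->
    hull f x -> cross (E l) x <= cross (E l) (toR R (f l)).
  move=> fr; apply: conv_hull_le; [exact: crossDr|exact: crossZr|].
  by move=> i; rewrite size_mkseq => im; rewrite nth_mkseq // -subr_le0 -crossBr.
exists (hull a), (hull b); split; try exact: integral_conv_hull.
- have [i im ki] := kpos.
  exists (toR R (a i.+1)), (toR R (a i)); split; try exact: hull_mem.
  move=> /toR_inj; rewrite aS modn_small // => /eqP.
  rewrite -subr_eq0 addrC addKr scalemx_eq0.
  have := edge_neq0 i; rewrite modn_small // => /negbTE ->.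
  rewrite orbF => /eqP; lia.
- have [i im ki] := klt.
  exists (toR R (b i.+1)), (toR R (b i)); split; try exact: hull_mem.
  move=> /eqP; rewrite -subr_eq0 bE scaler_eq0 (negbTE (E_neq0 polyP i)) orbF subr_eq0.
  move=> /eqP k1; have := ltxx (1 : R); rewrite {1}k1 /kap ltr_pdivrMr // mul1r ltr_nat.
  by rewrite [X in k X]modn_small // ki.
- apply/seteqP; split => x.
  + rewrite (polygon_conv_hullE polyP) => /conv_hullP[w []]; rewrite size_mkseq => w0 w1 ->.
    exists (\sum_(i < m) w i *: toR R (a i)).
      apply/conv_hullP; exists w; rewrite size_mkseq; split=> //.
      by apply: eq_bigr => i _; rewrite nth_mkseq.
    exists (\sum_(i < m) w i *: toR R (b i)).
      apply/conv_hullP; exists w; rewrite size_mkseq; split=> //.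
      by apply: eq_bigr => i _; rewrite nth_mkseq.
    rewrite -big_split; apply: eq_bigr => i _ /=.
    by rewrite nth_mkseq // -scalerDr -toRD /b addrC subrK.
  + move=> [y Ay [z Bz <-]]; apply/(polygon_halfplanes polyP) => l _.
    rewrite crossBr subr_le0 crossDr.
    have -> : cross (E l) (V l) = cross (E l) (toR R (a l)) + cross (E l) (toR R (b l)).
      by rewrite -crossDr; congr cross; rewrite -toRD /b addrC subrK.
    apply: lerD.
    * apply: hull_right Ay => i; apply: (walk_right polyP aE) => // j.
      by rewrite am.
    * apply: hull_right Bz => i; apply: (walk_right polyP bE) => // j.
        by rewrite subr_ge0.
      by rewrite bm.
Qed.

(** Both [a i.+1 + b i] and [a i + b i.+1] lie in [P], so on the right of edge [i]. Their values of
    [cross (e i)] relative to [v_i] add up to 0, so both are on the line of the edge. Thus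
    [a i.+1 - a i] is an integer multiple of [e i], and [edge_range] bounds the multiple. *)
Lemma summand_steps (A B : set 'rV[R]_2) (a b : nat -> 'rV[int]_2) :
  P = minkowski_sum A B ->
  (forall i, A (toR R (a i))) -> (forall i, B (toR R (b i))) ->
  (forall i, a i + b i = cyc v i) ->
  forall i, exists2 k : nat, (k <= n i)%N & a i.+1 = a i + k%:Z *: e i.
Proof.
move=> PAB Aa Bb ab i.
have n0 : (n i)%:Z != 0 by rewrite eqz_nat -lt0n edge_gt0.
have right u w : A (toR R u) -> B (toR R w) -> cross (e i) (u + w - cyc v i) <= 0.
  move=> Au Bw; have : P (toR R (u + w)).
    by rewrite PAB toRD; exists (toR R u) => //; exists (toR R w).
  move=> /(polygon_right polyP i); rewrite -!toRB edgeE addrAC subrr add0r cross_toR crossZl.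
  by rewrite lerz0 pmulr_rle0 // ltz_nat edge_gt0.
have := right _ _ (Aa i.+1) (Bb i); have := right _ _ (Aa i) (Bb i.+1).
have /eqP := edgeE i; rewrite -!ab -subr_eq => /eqP abS.
have {}abS : b i.+1 = a i + b i + (n i)%:Z *: e i - a i.+1 by rewrite -abS subrK addrC addKr.
rewrite {}abS !(crossBr, crossDr) crossZr crossxx mulr0 => h1 h2.
have : cross (e i) (a i.+1 - a i) = 0 by rewrite crossBr; lia.
move=> /(primitive_parallel (edge_coprime i))[k kE].
have {}kE : a i.+1 = a i + k *: e i by rewrite -kE addrC subrK.
have : P (V i + toR R (k *: e i)).
  rewrite -toRD -ab addrAC -kE toRD PAB; exists (toR R (a i.+1)) => //.
  by exists (toR R (b i)).
move=> /edge_range; case: k kE => // k kE kn; exists k => //; lia.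
Qed.

(** If [a] never moves, each [z] in [A] has [cross (E i) (z - a 0) <= 0] for every edge, because
    [z + b i] is in [P]; then [polygon_normals] reduces [A] to a point. *)
Lemma summand_moves (A B : set 'rV[R]_2) (a b : nat -> 'rV[int]_2) :
  P = minkowski_sum A B -> more_than_one_point A ->
  (forall i, B (toR R (b i))) -> (forall i, a i + b i = cyc v i) ->
  exists2 i, (i < m)%N & a i.+1 <> a i.
Proof.
move=> PAB [x [y [Ax Ay xy]]] Bb ab; apply: contrapT => noMove; apply: xy.
have a0 i : (i <= m)%N -> a i = a 0%N.
  elim: i => // i IHi im; rewrite -IHi ?(ltnW im) //.
  by apply: contrapT => ai; apply: noMove; exists i.
have point z : A z -> z = toR R (a 0%N).
  move=> Az; apply/eqP; rewrite -subr_eq0; apply/eqP.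
  apply: (polygon_normals polyP) => i im.
  have -> : z - toR R (a 0%N) = z + toR R (b i) - V i.
    by rewrite -ab toRD (a0 i (ltnW im)) opprD addrACA subrr addr0.
  by apply: (polygon_right polyP); rewrite PAB; exists z => //; exists (toR R (b i)).
by rewrite (point x Ax) (point y Ay).
Qed.

(** The closed walks that the algorithm can trace: the strict bound at [m.-1] matches the range
    [k < n] of [last_step], and the nonzero step excludes the trivial walk. *)
Definition summand_walk (k : nat -> nat) (p : nat -> 'rV[int]_2) : Prop :=
  [/\ p 0%N = cyc v 0 /\ p m = cyc v 0,
      forall i, P (toR R (p i)),
      forall i, p i.+1 = p i + (k i)%:Z *: e i /\ (k i <= n i)%N,
      exists2 i, (i < m)%N & (0 < k i)%N &
      (k m.-1 < n m.-1)%N].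

Lemma decomposable_walk : decomposable P -> exists k p, summand_walk k p.
Proof.
move=> [A [B [intA intB A1 B1 PAB]]]; have mgt := polygon_size polyP.
have PBA : P = minkowski_sum B A by rewrite minkowski_sumC.
have ABex i : exists ab : 'rV[int]_2 * 'rV[int]_2,
    [/\ A (toR R ab.1), B (toR R ab.2) & ab.1 + ab.2 = cyc v i].
  have := polygon_vertex polyP i; have := polygon_V polyP i.
  rewrite {1}PAB => -[x Ax [y By xy]] xyv.
  have [a xa] : exists a, x = toR R a.
    by apply: intA.2; apply: minkowski_vertexl Ax By _; rewrite -PAB xy.
  have [b yb] : exists b, y = toR R b.
    by apply: intB.2; apply: minkowski_vertexl By Ax _; rewrite -PBA addrC xy.
  by exists (a, b); split; rewrite /= -?xa -?yb //; apply: (@toR_inj R); rewrite toRD -xa -yb.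
have [ab0 ab0P] := choice ABex.
(* Reading the chosen splittings at [i %% m] makes [a] and [b] return to their starting points. *)
pose a i := (ab0 (i %% m)%N).1; pose b i := (ab0 (i %% m)%N).2.
have Aa i : A (toR R (a i)) by case: (ab0P (i %% m)%N).
have Bb i : B (toR R (b i)) by case: (ab0P (i %% m)%N).
have ab i : a i + b i = cyc v i by rewrite -cyc_mod; case: (ab0P (i %% m)%N).
have ba i : b i + a i = cyc v i by rewrite addrC.
have am : a m = a 0%N by rewrite /a modnn mod0n.
have bm : b m = b 0%N by rewrite /b modnn mod0n.
have walk (A' B' : set 'rV[R]_2) (a' b' : nat -> 'rV[int]_2) (k : nat -> nat) :
    P = minkowski_sum A' B' -> more_than_one_point A' ->
    (forall i, A' (toR R (a' i))) -> (forall i, B' (toR R (b' i))) ->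
    (forall i, a' i + b' i = cyc v i) -> a' m = a' 0%N ->
    (forall i, (k i <= n i)%N) -> (forall i, a' i.+1 = a' i + (k i)%:Z *: e i) ->
    (k m.-1 < n m.-1)%N ->
    exists k p, summand_walk k p.
  move=> PAB' A1' Aa' Bb' ab' am' kn aS klt.
  (* Translation by [b' 0] makes the walk start at [v_0] and keeps it in the Minkowski sum. *)
  exists k, (fun i => a' i + b' 0%N); split=> //.
  - by rewrite am' ab'.
  - by move=> i; rewrite PAB' toRD; exists (toR R (a' i)) => //; exists (toR R (b' 0%N)).
  - by move=> i; rewrite aS addrAC.
  - have [i im ai] := summand_moves PAB' A1' Bb' ab'; exists i => //.
    by rewrite lt0n; apply/eqP => k0; apply: ai; rewrite aS k0 scale0r addr0.
have /choice[k kP] : forall i, exists k : nat, (k <= n i)%N /\ a i.+1 = a i + k%:Z *: e i.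
  by move=> i; have [k] := summand_steps PAB Aa Bb ab i; exists k.
have kn i : (k i <= n i)%N by case: (kP i).
have aS i : a i.+1 = a i + (k i)%:Z *: e i by case: (kP i).
(* If [a] runs along the whole last edge, then [b] does not move there; exchanging the summands
   gives a last multiple of 0. *)
have := kn m.-1; rewrite leq_eqVlt => /orP[/eqP kE|]; last exact: (walk A B a b).
apply: (walk B A b a (fun i => n i - k i)%N) => //.
- by move=> i; exact: leq_subr.
- move=> i; have -> : b i.+1 = cyc v i.+1 - a i.+1 by rewrite -ba addrK.
  rewrite edgeE aS -ba -subzn // scalerBl opprD addrACA addrK; congr (_ + _).
- by rewrite kE subnn edge_gt0.
Qed.

End Decomposition.

(** * Semantics and cost of the algorithm *)

Section Loops.

Lemma for_each_rcons (I T : Type) (s : seq I) x (body : I -> T -> counted T) a :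
  (for_each (rcons s x) body a).2 = (body x (for_each s body a).2).2.
Proof. by elim: s a => //= y s IHs a. Qed.

Lemma for_each_mem (I : eqType) (U : choiceType) (s : seq I)
    (body : I -> {fset U} -> counted {fset U}) (Q : I -> U -> Prop) :
  (forall i A z, z \in (body i A).2 <-> z \in A \/ Q i z) ->
  forall A z, z \in (for_each s body A).2 <-> z \in A \/ exists2 i, i \in s & Q i z.
Proof.
move=> bodyQ; elim: s => [|i s IHs] A z /=.
  by split=> [|[//|[]]]; first by left.
rewrite IHs bodyQ; split=> [[[zA|Qz]|[j js Qz]]|[zA|[j + Qz]]].
- by left.
- by right; exists i; rewrite ?mem_head.
- by right; exists j; rewrite // inE js orbT.
- by left; left.
- by rewrite inE => /orP[/eqP <-|js]; [left; right|right; exists j].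
Qed.

(** The cost of an iteration may depend on the accumulator, as [middle_step] scans the whole current
    set; [Inv] provides the bound on it. *)
Lemma for_each_cost (I : eqType) (T : Type) (s : seq I) (body : I -> T -> counted T)
    (Inv : T -> Prop) (c : I -> nat) :
  (forall i a, i \in s -> Inv a -> Inv (body i a).2 /\ (body i a).1 <= c i) ->
  forall a, Inv a ->
  Inv (for_each s body a).2 /\ (for_each s body a).1 <= \sum_(i <- s) c i.
Proof.
elim: s => [|i s IHs] bodyP a Ia /=; first by rewrite big_nil.
have [Ib cb] := bodyP i a (mem_head _ _) Ia.
rewrite big_cons; have [|Is cs] := IHs _ _ Ib.
  by move=> j b js; apply: bodyP; rewrite inE js orbT.
by split=> //; rewrite leq_add.
Qed.

Lemma for_each_cost_const (I : eqType) (T : Type) (s : seq I)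
    (body : I -> T -> counted T) (c : nat) :
  (forall i a, i \in s -> (body i a).1 <= c) ->
  forall a, (for_each s body a).1 <= size s * c.
Proof.
move=> bodyc a; have [] := @for_each_cost _ _ s body (fun _ => True) (fun _ => c) _ a Logic.I.
  by move=> i b /bodyc.
by rewrite big_const_seq count_predT iter_addn_0 mulnC.
Qed.

End Loops.

(** * Membership and operation counts for the pieces of the algorithm *)

Section Algorithm.
Import Order.TTheory GRing.Theory Num.Theory.
Local Open Scope ring_scope.
Implicit Types (IP A : {fset 'rV[int]_2}) (u e z : 'rV[int]_2).

Lemma try_adjoin_mem IP u e k A z :
  z \in (try_adjoin IP u e k A).2 <-> z \in A \/ (z = u + k%:Z *: e /\ z \in IP).
Proof.
rewrite /try_adjoin /=; case: ifP => pIP /=.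
  rewrite in_fset1U; split=> [/orP[/eqP ->|]|[->|[->]]]; rewrite ?eqxx ?orbT //; tauto.
by split=> [|[//|[-> ]]]; [left|rewrite pIP].
Qed.

(** One scaling, one addition and at most one adjunction. *)
Lemma try_adjoin_cost IP u e k A : ((try_adjoin IP u e k A).1 <= 3)%N.
Proof. by rewrite /try_adjoin /=; case: ifP. Qed.

Lemma adjoin_multiples_mem IP u e ks A z :
  z \in (for_each ks (try_adjoin IP u e) A).2 <->
  z \in A \/ exists2 k : nat, k \in ks & z = u + k%:Z *: e /\ z \in IP.
Proof.
apply: (@for_each_mem _ _ ks (try_adjoin IP u e)
  (fun k y => y = u + k%:Z *: e /\ y \in IP)) => k B y; exact: try_adjoin_mem.
Qed.

Lemma adjoin_multiples_cost IP u e ks A :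
  ((for_each ks (try_adjoin IP u e) A).1 <= size ks * 3)%N.
Proof. by apply: for_each_cost_const => k B _; exact: try_adjoin_cost. Qed.

Lemma adjoin_sums_mem IP (us : seq 'rV[int]_2) e ks A z :
  z \in (for_each us (fun u => for_each ks (try_adjoin IP u e)) A).2 <->
  z \in A \/ exists2 u, u \in us & exists2 k : nat, k \in ks & z = u + k%:Z *: e /\ z \in IP.
Proof.
apply: (@for_each_mem _ _ us (fun u => for_each ks (try_adjoin IP u e))
  (fun u y => exists2 k : nat, k \in ks & y = u + k%:Z *: e /\ y \in IP)) => u B y.
exact: adjoin_multiples_mem.
Qed.

Lemma middle_step_mem IP (v0 : 'rV[int]_2) n e A z :
  z \in (middle_step IP v0 (n, e) A).2 <->
  z \in IP /\ ((exists2 k : nat, (0 < k <= n)%N & z = v0 + k%:Z *: e) \/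
               exists2 u, u \in A & exists2 k : nat, (k <= n)%N & z = u + k%:Z *: e).
Proof.
apply: iff_trans (adjoin_sums_mem _ _ _ _ _ _) _.
rewrite adjoin_multiples_mem in_fset0; split.
- case=> [[//|[k]]|[u uA [k]]]; rewrite mem_iota => kn [zE zIP]; split=> //.
    by left; exists k.
  by right; exists u => //; exists k.
- case=> zIP [[k kn zE]|[u uA [k kn zE]]].
    by left; right; exists k => //; rewrite mem_iota.
  by right; exists u => //; exists k => //; rewrite mem_iota.
Qed.

Lemma middle_step_cost IP (v0 : 'rV[int]_2) n e A :
  ((middle_step IP v0 (n, e) A).1 <= n * 3 + #|` A| * (n.+1 * 3))%N.
Proof.
rewrite /middle_step /= leq_add //.
  by have := adjoin_multiples_cost IP v0 e (iota 1 n) fset0; rewrite size_iota.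
apply: for_each_cost_const => u B _.
by have := adjoin_multiples_cost IP u e (iota 0 n.+1) B; rewrite size_iota.
Qed.

Lemma last_step_mem IP n e A z :
  z \in (last_step IP (n, e) A).2 <->
  z \in IP /\ exists2 u, u \in A & exists2 k : nat, (k < n)%N & z = u + k%:Z *: e.
Proof.
apply: iff_trans (adjoin_sums_mem _ _ _ _ _ _) _.
rewrite in_fset0; split.
- by case=> [//|[u uA [k]]]; rewrite mem_iota => kn [zE zIP]; split=> //; exists u => //; exists k.
- by case=> zIP [u uA [k kn zE]]; right; exists u => //; exists k => //; rewrite mem_iota.
Qed.

Lemma last_step_cost IP n e A :
  ((last_step IP (n, e) A).1 <= #|` A| * (n * 3))%N.
Proof.
apply: for_each_cost_const => u B _.
by have := adjoin_multiples_cost IP u e (iota 0 n) B; rewrite size_iota.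
Qed.

Local Notation edge0 := (0%N, 0 : 'rV[int]_2).

(** A form of the edge relation without cyclic indices, stable under dropping the first edge and
    shifting [p], as induction on [es] requires. *)
Definition follows (p : nat -> 'rV[int]_2) (es : seq (nat * 'rV[int]_2)) : Prop :=
  forall i, (i < size es)%N ->
    p i.+1 = p i + (nth edge0 es i).1%:Z *: (nth edge0 es i).2.

Lemma located_edgesE p es : follows p es ->
  located_edges (p 0%N) es =
    ((2 * size es)%N, mkseq (fun i => (p i, (nth edge0 es i).2)) (size es)).
Proof.
elim: es p => [//|[n e] es IHes] p pes; rewrite /= /bind /vscale /vadd /ret /=.
have /= <- := pes 0%N isT.
rewrite (IHes (p \o succn)) => [|i ies]; last by have := pes i.+1 ies.
rewrite /= /mkseq /= (iotaDl 1 0) -map_comp; congr (_, _); lia.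
Qed.

Lemma follows_radius p es : follows p es ->
  forall i c, (i <= size es)%N -> (`|p i 0%R c - p 0%N 0%R c| <= radius es)%N.
Proof.
move=> pes i c ies.
(* The induction bounds the displacement after [i] edges by the radius of these edges alone. *)
have -> : radius es = (radius (take i es) + radius (drop i es))%N.
  by rewrite /radius -big_cat cat_take_drop.
apply: leq_trans (leq_addr _ _); elim: i ies => [|i IHi] ies.
  by rewrite subrr.
rewrite (take_nth edge0 ies) /radius big_rcons /= -/(radius _) pes // !mxE.
have := IHi (ltnW ies); set E := nth _ _ _.
have : (`|E.2 0%R c| <= maxn `|E.2 0%R 0%R| `|E.2 0%R 1%R|)%N.
  case: (unliftP 0 c) => [k ->|->]; last exact: leq_maxl.
  by rewrite (ord1 k) (_ : lift _ _ = 1) ?leq_maxr //; apply: val_inj.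
move: (maxn _ _) (radius _) => M r; set y := E.2 0 c => yM.
have : (`|(E.1%:Z * y)%R| <= E.1 * M)%N by rewrite abszM leq_mul.
move: (E.1%:Z * y) (E.1 * M)%N => w b wb pr.
rewrite addrAC; move: (p i 0 c - p 0%N 0 c) pr => d pr; lia.
Qed.

Lemma box_uniq (v0 : 'rV[int]_2) r : uniq (box v0 r).
Proof.
apply: allpairs_uniq; rewrite ?iota_uniq // => -[i j] [i' j'] _ _ /= ij.
have := congr1 (fun f : 'rV[int]_2 => f 0 0) ij.
have := congr1 (fun f : 'rV[int]_2 => f 0 1) ij.
by rewrite !mxE /= => /addrI [->] /addrI [->].
Qed.

Lemma mem_box (v0 : 'rV[int]_2) r z :
  (forall c, (`|z 0%R c - v0 0%R c| <= r)%N) -> z \in box v0 r.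
Proof.
move=> zr; have shift (x y : int) : (`|(x - y)%R| <= r)%N ->
    (`|(x - y + r%:Z)%R| < r.*2.+1)%N /\ x = y - r%:Z + `|(x - y + r%:Z)%R|%N%:Z by lia.
have [i0 z0] := shift _ _ (zr 0); have [i1 z1] := shift _ _ (zr 1).
apply/allpairsP; exists (`|(z 0 0 - v0 0 0 + r%:Z)%R|%N, `|(z 0 1 - v0 0 1 + r%:Z)%R|%N).
by rewrite !mem_iota; split=> //; apply: row2P; rewrite mxE.
Qed.

Lemma mem_compute_IP p es z : follows p es ->
  z \in (compute_IP (p 0%N) es).2 <->
  z \in box (p 0%N) (radius es) /\
  forall i, (i < size es)%N -> cross (nth edge0 es i).2 (z - p i) <= 0.
Proof.
move=> pes; rewrite /compute_IP (located_edgesE pes); move: (box _ _) => bx /=; set l := mkseq _ _.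
rewrite (for_each_mem _ (Q := fun i y => all (right_of^~ i) l /\ y = i)); last first.
  move=> i A y; case: ifP => il /=; last by split=> [|[//|[]//]]; left.
  by rewrite in_fset1U; split=> [/orP[/eqP ->|yA]|[->|[_ ->]]]; rewrite ?eqxx ?orbT //;
    [right|left].
have lP : all (right_of^~ z) l <->
    forall i, (i < size es)%N -> cross (nth edge0 es i).2 (z - p i) <= 0.
  split=> [/(all_nthP (0, 0)) zl i ies|zr].
    have := zl i; rewrite size_mkseq => /(_ ies); rewrite nth_mkseq //.
    by rewrite /right_of /cross !mxE.
  apply/(all_nthP (0, 0)) => i; rewrite size_mkseq => ies; rewrite nth_mkseq //.
  by have := zr i ies; rewrite /right_of /cross !mxE.
rewrite in_fset0 -lP; split=> [[//|[i ib [il ->]]]|[zb zl]] //.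
by right; exists z.
Qed.

(** Locating an edge costs one scaling and one addition. Half-plane tests are free, and the
    candidates in the box are distinct, so each adjunction brings a new point. *)
Lemma compute_IP_cost p es : follows p es ->
  ((compute_IP (p 0%N) es).1 <= 2 * size es + #|` (compute_IP (p 0%N) es).2|)%N.
Proof.
move=> pes; have memIP z := mem_compute_IP z pes.
move: memIP (box_uniq (p 0%N) (radius es)); rewrite /compute_IP (located_edgesE pes).
move: (box _ _) => bx /=; set l := mkseq _ _ => memIP bxU.
rewrite leq_add2l.
have [|_ cost] := @for_each_cost _ _ bx
    (fun z IP => if all (right_of^~ z) l then adjoin z IP else ret IP)
    (fun _ => True) (fun z => all (right_of^~ z) l) _ fset0 Logic.I.
  by move=> z IP _ _; case: ifP.
apply: leq_trans cost _.
rewrite (eq_bigr (fun z => if all (right_of^~ z) l then 1 else 0)%N); last by move=> z _; case: ifP.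
rewrite -big_mkcond sum1_count -size_filter; apply: uniq_leq_size.
  exact: filter_uniq.
move=> z; rewrite mem_filter => /andP[zl zb]; apply/memIP; split=> // i ies.
move/(all_nthP (0, 0)): zl => /(_ i); rewrite size_mkseq => /(_ ies); rewrite nth_mkseq //.
by rewrite /right_of /cross !mxE.
Qed.

(** * Reached points as ends of partial walks along the edges *)

Section Reachability.
Variables (IP : {fset 'rV[int]_2}) (v0 : 'rV[int]_2) (es : seq (nat * 'rV[int]_2)).
Local Notation n i := (nth edge0 es i).1.
Local Notation e i := (nth edge0 es i).2.

(** For [i < m] this is the set [A_i] of the algorithm. *)
Definition reached i := (for_each (take i es) (middle_step IP v0) fset0).2.

Lemma reachedS i : (i < size es)%N ->
  reached i.+1 = (middle_step IP v0 (n i, e i) (reached i)).2.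
Proof. by move=> ies; rewrite /reached (take_nth edge0 ies) for_each_rcons -surjective_pairing. Qed.

(** [A_0] is empty and a walk leaves [v_0] only with [k > 0], so every reached point comes from a
    walk with a nonzero multiple. *)
Lemma reached_walk i z : (i <= size es)%N -> z \in reached i ->
  exists k : nat -> nat,
    [/\ forall j, (j < i)%N -> (k j <= n j)%N,
        exists2 j, (j < i)%N & (0 < k j)%N &
        z = v0 + \sum_(j < i) (k j)%:Z *: e j].
Proof.
elim: i z => [|i IHi] z ies; first by rewrite /reached take0 in_fset0.
rewrite reachedS // => /middle_step_mem[_ [[k /andP[k0 kn] ->]|[u /(IHi _ (ltnW ies))]]].
  exists (fun j => if j == i then k else 0%N); split.
  - by move=> j _; case: eqP => [->|].
  - by exists i; rewrite ?eqxx.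
  - rewrite big_ord_recr /= eqxx big1 ?add0r // => j _.
    by rewrite ltn_eqF // scale0r.
case=> k [kn [j ji kj] uE] [k' k'n ->].
exists (fun j => if j == i then k' else k j); split.
- by move=> j'; rewrite ltnS leq_eqVlt; case: eqP => [->|_ /kn].
- by exists j; [exact: leqW|rewrite ltn_eqF].
- rewrite big_ord_recr /= eqxx addrA uE; congr (_ + _ + _); apply: eq_bigr => j' _.
  by rewrite ltn_eqF.
Qed.

(** Before its first nonzero step the walk rests at [v_0]. That step enters through the points
    [v_0 + k e_i] with [k > 0]; later steps, zero or not, extend a point already reached. *)
Lemma walk_reached (k : nat -> nat) (p : nat -> 'rV[int]_2) :
  p 0%N = v0 -> (forall j, (j < size es)%N -> p j.+1 = p j + (k j)%:Z *: e j) ->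
  (forall j, p j \in IP) -> (forall j, (j < size es)%N -> (k j <= n j)%N) ->
  forall i, (i <= size es)%N -> (exists2 j, (j < i)%N & (0 < k j)%N) -> p i \in reached i.
Proof.
move=> p0 pS pIP kn; elim=> [|i IHi] ies [j ji kj]; first by [].
rewrite reachedS // pS //; apply/middle_step_mem; split; first by rewrite -pS.
have [[j' ji' kj']|none] := pselect (exists2 j, (j < i)%N & (0 < k j)%N).
  right; exists (p i); first by apply: IHi; [exact: ltnW|exists j'].
  by exists (k i) => //; exact: kn.
have jiE : j = i.
  by apply/eqP; move: ji; rewrite ltnS leq_eqVlt => /orP[//|ji]; case: none; exists j.
left; exists (k i); first by rewrite -{1}jiE kj kn.
congr (_ + _); rewrite -p0; have : (i <= i)%N by [].
elim: {-2}i => // i' IHi' i'i; rewrite pS; last by apply: leq_trans ies; exact: leqW.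
rewrite IHi' ?(ltnW i'i) // (_ : k i' = 0%N) ?scale0r ?addr0 //.
by apply/eqP; rewrite -leqn0 leqNgt; apply/negP => ki'; apply: none; exists i'.
Qed.

Lemma reached_subset i : (i <= size es)%N -> {subset reached i <= IP}.
Proof.
case: i => [|i] ies z; first by rewrite /reached take0 in_fset0.
by rewrite reachedS // => /middle_step_mem[].
Qed.

End Reachability.

End Algorithm.

(** The terms count, in order, locating the edges, adjoining the points of [IP], the [m.-1] middle
    steps and the last step. The constant 12 leaves slack. *)
Lemma cost_arith (c t m N : nat) : c <= t -> 0 < t -> 0 < m -> 0 < N ->
  2 * m + c + ((N * 3 + t * (N * 3)) * m.-1 + t * (N * 3)) <= 12 * (t * m * N).
Proof. by case: m => // m; case: t => // t; case: N => // N ct _ _ _ /=; nia. Qed.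

(** * Correctness and total cost on an integral polygon *)

Section Correctness.
Import Order.TTheory GRing.Theory Num.Theory.
Local Open Scope classical_set_scope.
Local Open Scope ring_scope.

Variables (R : realType) (P : set 'rV[R]_2) (v : seq 'rV[int]_2).
Variable es : seq (nat * 'rV[int]_2).
Hypothesis polyP : integral_polygon P v.
Hypothesis edgesP : edge_sequence v es.

Local Notation V i := (toR R (cyc v i)).
Local Notation m := (size v).
Local Notation n i := (nth (0%N, 0) es i).1.
Local Notation e i := (nth (0%N, 0) es i).2.
Local Notation IP := (compute_IP (cyc v 0) es).2.
Local Notation t := (nb_integral_points P).
Local Notation N := (max_edge_points R v).

Lemma size_edges : size es = m.
Proof. by case: edgesP. Qed.

Lemma follows_cyc : follows (cyc v) es.
Proof.
by move=> i; rewrite size_edges => im; have := edgeE polyP edgesP i; rewrite modn_small.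
Qed.

(** Each coordinate and its opposite are linear, so the bounds that [follows_radius] gives at the
    vertices hold on all of [P]. *)
Lemma polygon_box (z : 'rV[int]_2) : P (toR R z) -> z \in box (cyc v 0) (radius es).
Proof.
rewrite (polygon_conv_hullE polyP) => Pz; apply: mem_box => c.
have bound i : (i < m)%N -> (`|cyc v i 0%R c - cyc v 0 0%R c| <= radius es)%N.
  by move=> im; apply: (follows_radius follows_cyc); rewrite size_edges ltnW.
have up : z 0 c <= cyc v 0 0 c + (radius es)%:Z.
  rewrite -(ler_int R).
  have := @conv_hull_le _ _ _ (fun x => x 0 c)
    (cyc v 0 0 c + (radius es)%:Z)%:~R _ _ _ _ Pz.
  rewrite mxE; apply.
  - by move=> x y; rewrite mxE.
  - by move=> a x; rewrite mxE.
  - move=> i; rewrite size_mkseq => im; rewrite nth_mkseq // mxE ler_int.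
    have := bound i im; move: (cyc v i 0 c) (cyc v 0 0 c) => x y; lia.
have lo : cyc v 0 0 c - (radius es)%:Z <= z 0 c.
  rewrite -(ler_int R).
  have := @conv_hull_le _ _ _ (fun x => - x 0 c)
    (- (cyc v 0 0 c - (radius es)%:Z)%:~R) _ _ _ _ Pz.
  rewrite mxE lerN2; apply.
  - by move=> x y; rewrite mxE opprD.
  - by move=> a x; rewrite mxE mulrN.
  - move=> i; rewrite size_mkseq => im; rewrite nth_mkseq // mxE lerN2 ler_int.
    have := bound i im; move: (cyc v i 0 c) (cyc v 0 0 c) => x y; lia.
move: (z 0 c) (cyc v 0 0 c) up lo => x y; lia.
Qed.

Lemma mem_IP z : z \in IP <-> P (toR R z).
Proof.
(* The algorithm tests with primitive vectors; since [n i > 0], the test with the whole edge has the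
   same sign. *)
have right i : (i < m)%N ->
    (cross (e i) (z - cyc v i) <= 0) = (cross (V i.+1 - V i) (toR R z - V i) <= 0).
  move=> im; have := toR_edgeE polyP edgesP i; rewrite modn_small // => ->.
  have := edge_gt0 polyP edgesP i; rewrite modn_small // => n0.
  by rewrite -toRB crossZl cross_toR pmulr_rle0 ?ltr0n // lerz0.
rewrite (mem_compute_IP _ follows_cyc) size_edges; split=> [[_ zr]|Pz].
  by apply/(polygon_halfplanes polyP) => i im; rewrite -right // zr.
split; first exact: polygon_box.
by move=> i im; rewrite right //; exact: (polygon_right polyP).
Qed.

(** Finiteness is what makes the cardinals taken through [fset_set] meaningful. *)
Lemma integral_points_finite (A : set 'rV[R]_2) :
  A `<=` P -> finite_set (integral_points A).
Proof.
move=> AP; apply: (@sub_finite_set _ _ [set` box (cyc v 0) (radius es)]).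
  by move=> z /AP Pz; exact: polygon_box.
exact: finite_seq.
Qed.

Lemma mem_integral_points (A : set 'rV[R]_2) z :
  A `<=` P -> (z \in fset_set (integral_points A)) = `[< A (toR R z) >].
Proof.
move=> AP; rewrite in_fset_set; last exact: integral_points_finite.
by apply/idP/asboolP => [/set_mem //|Az]; exact: mem_set.
Qed.

Lemma card_IP : (#|` IP| <= t)%N.
Proof.
apply: fsubset_leq_card; apply/fsubsetP => z /mem_IP Pz.
by rewrite mem_integral_points //; apply/asboolP.
Qed.

Lemma nb_integral_points_gt0 : (0 < t)%N.
Proof.
rewrite cardfs_gt0; apply/fset0Pn; exists (cyc v 0).
by rewrite mem_integral_points //; apply/asboolP; exact: (polygon_V polyP).
Qed.

(** The edge carries the [n i + 1] distinct points [v_i + k e_i] with [k <= n i]. Strictness absorbs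
    the [n.+1] multiples tried by [middle_step]. *)
Lemma edge_points i : (i < m)%N -> (n i < N)%N.
Proof.
move=> im; set S := conv_hull [:: V i; V i.+1].
have SP : S `<=` P.
  by apply: (polygon_conv_hull_sub polyP) => -[|[|//]] _; exact: (polygon_V polyP).
apply: leq_trans (leq_bigmax (Ordinal im)); rewrite /= -/S.
have nE : (n i)%:R != 0 :> R.
  by have := edge_gt0 polyP edgesP i; rewrite modn_small // lt0n pnatr_eq0.
have e0 : e i != 0 by have := edge_neq0 polyP edgesP i; rewrite modn_small.
rewrite -[(n i).+1](size_mkseq (fun k : nat => cyc v i + k%:Z *: e i)).
apply: uniq_leq_size.
  rewrite /mkseq map_inj_uniq ?iota_uniq // => k k' /addrI /eqP.
  by rewrite -subr_eq0 -scalerBl scalemx_eq0 (negbTE e0) orbF subr_eq0 => /eqP[].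
move=> z /mapP[k]; rewrite mem_iota ltnS => /= kn ->.
rewrite mem_integral_points //; apply/asboolP/conv_hullP.
exists (nth 0 [:: 1 - k%:R / (n i)%:R; k%:R / (n i)%:R]); split.
- have k1 : k%:R / (n i)%:R <= 1 :> R.
    by rewrite ler_pdivrMr ?mul1r ?ler_nat // lt0r nE ler0n.
  by case=> [|[|[|j]]] //=; rewrite ?subr_ge0 ?divr_ge0.
- by rewrite !big_ord_recl big_ord0 /= addr0 subrK.
- rewrite !big_ord_recl big_ord0 /= addr0.
  have := toR_edgeE polyP edgesP i; rewrite modn_small // => /(canRL (subrK _)) ->.
  by rewrite toRD toRZ; apply: row2P; rewrite !mxE; field.
Qed.

Lemma polydecomp_correct :
  (polydecomp (cyc v 0) es).2 = Decomposable <-> decomposable P.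
Proof.
have mgt := polygon_size polyP.
rewrite /polydecomp /= size_edges -/(reached IP (cyc v 0) es m.-1).
have mE : m = m.-1.+1 by lia.
rewrite (surjective_pairing (nth _ _ _)).
set L := last_step _ _ _.
have -> : ((if cyc v 0 \in L.2 then Decomposable else Indecomposable) = Decomposable)
    <-> cyc v 0 \in L.2 by case: ifP.
rewrite last_step_mem; split.
- case=> _ [u + [k' k'n uE]] => /reached_walk.
  rewrite size_edges leq_pred => -[//|k [kn [j jm kj] uk]].
  pose K j := if j == m.-1 then k' else k j.
  apply: (@walk_decomposable _ _ _ _ polyP edgesP K).
  + move=> i; rewrite /K => im; rewrite modn_small //; case: eqP => [->|ine]; first exact: ltnW.
    by apply: kn; lia.
  + rewrite (eq_bigr (fun i : 'I_m => (K i)%:Z *: e i)); last by move=> i _; rewrite modn_small.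
    move: uE; rewrite uk -addrA => /eqP.
    rewrite -subr_eq0 opprD addrA subrr add0r oppr_eq0 => /eqP uE.
    have sumS (F : nat -> 'rV[int]_2) : \sum_(i < m) F i = \sum_(i < m.-1) F i + F m.-1.
      by move: mE; move: m.-1 => M ->; rewrite big_ord_recr.
    rewrite (sumS (fun i => (K i)%:Z *: e i)); apply: etrans uE.
    rewrite {2}/K eqxx; congr (_ + _); apply: eq_bigr => i _.
    by rewrite /K ltn_eqF.
  (* A positive multiple before the last edge and [k' < n] on the last one exclude the two trivial
     choices. *)
  + by exists j; [lia | rewrite /K ltn_eqF].
  + by exists m.-1; [lia | rewrite /K eqxx modn_small //; lia].
- move=> /(decomposable_walk polyP edgesP)[k [p [[p0 pm] pP pS [i im ki] klt]]].
  have pIP j : p j \in IP by apply/mem_IP.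
  have pS' j : (j < size es)%N -> p j.+1 = p j + (k j)%:Z *: e j.
    by rewrite size_edges => jm; have [+ _] := pS j; rewrite modn_small.
  have kn j : (j < size es)%N -> (k j <= n j)%N.
    by rewrite size_edges => jm; have [_] := pS j; rewrite modn_small.
  have mm : (m.-1 < size es)%N by rewrite size_edges; lia.
  split; first by have := pIP 0%N; rewrite p0.
  exists (p m.-1); last first.
    exists (k m.-1); first by move: klt; rewrite modn_small // -{2}size_edges.
    by rewrite -pS' // -mE pm.
  apply: walk_reached pIP kn _ _ _ => //; first exact: ltnW.
  (* If all steps before the last were 0, then [p m.-1] would be [v_0], and closing the walk would
     force [k m.-1 = 0], against the existence of a nonzero step. *)
  apply: contrapT => none.
  have p0E j : (j <= m.-1)%N -> p j = p 0%N.
    elim: j => // j IHj jm; rewrite pS' ?(ltn_trans jm) // IHj ?(ltnW jm) //.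
    rewrite (_ : k j = 0%N) ?scale0r ?addr0 //.
    by apply/eqP; rewrite -leqn0 leqNgt; apply/negP => kj; apply: none; exists j.
  have /eqP := pS' _ mm; rewrite -mE pm p0E // p0 -subr_eq0 opprD addrA subrr add0r oppr_eq0.
  have := edge_neq0 polyP edgesP m.-1; rewrite modn_small; last by lia.
  rewrite scalemx_eq0 => /negbTE ->; rewrite orbF => /eqP k0.
  by apply: none; exists i => //; move: ki k0; have [->|] := eqVneq i m.-1; lia.
Qed.

Lemma polydecomp_cost : ((polydecomp (cyc v 0) es).1 <= 12 * (t * m * N))%N.
Proof.
have mgt := polygon_size polyP; have t0 := nb_integral_points_gt0.
have cIP := card_IP; have sE := size_edges.
have subIP (A : {fset 'rV[int]_2}) : {subset A <= IP} -> (#|` A| <= t)%N.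
  by move=> AIP; apply: leq_trans cIP; apply: fsubset_leq_card; apply/fsubsetP.
have nN ne : ne \in es -> (ne.1 < N)%N.
  by move=> /(nthP (0%N, 0))[i]; rewrite sE => im <-; exact: edge_points.
have -> : (polydecomp (cyc v 0) es).1 = ((compute_IP (cyc v 0) es).1 +
   ((for_each (take (size es).-1 es) (middle_step IP (cyc v 0)) fset0).1 +
    (last_step IP (nth (0%N, 0%R) es (size es).-1)
       (reached IP (cyc v 0) es (size es).-1)).1))%N.
  (* The final [ret] costs 0. *)
  by rewrite -[X in (_ + (_ + X))%N]addn0.
have c1 := compute_IP_cost follows_cyc.
(* The invariant keeps each [A_i] inside [IP], hence of at most [t] points, and [n.+1 <= N]
   multiples are tried from each. *)
have [||_ c2] := @for_each_cost _ _ (take (size es).-1 es) (middle_step IP (cyc v 0))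
  (fun A => {subset A <= IP}) (fun _ => N * 3 + t * (N * 3))%N _ fset0.
- move=> [k u] A /mem_take /nN /= kN AIP; split; first by move=> z /middle_step_mem[].
  apply: leq_trans (middle_step_cost _ _ _ _ _) _.
  apply: leq_add; first by rewrite leq_mul2r ltnW.
  by rewrite leq_mul ?subIP // leq_mul2r kN.
- by move=> z; rewrite in_fset0.
have c3 : ((last_step IP (nth (0%N, 0%R) es (size es).-1)
    (reached IP (cyc v 0) es (size es).-1)).1 <= t * (N * 3))%N.
  rewrite (surjective_pairing (nth _ _ _)).
  apply: leq_trans (last_step_cost _ _ _ _) _; apply: leq_mul.
    by apply/subIP/reached_subset; exact: leq_pred.
  by rewrite leq_mul2r ltnW // nN // mem_nth // sE; lia.
move: c1 c2 c3; rewrite big_const_seq count_predT iter_addn_0 size_take sE => c1 c2 c3.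
have N0 : (0 < N)%N by have := edge_points (ltnW (ltnW mgt)); lia.
apply: leq_trans (leq_add c1 (leq_add c2 c3)) _.
rewrite ltn_predL (ltnW (ltnW mgt)).
apply: cost_arith => //; exact: ltnW (ltnW mgt).
Qed.

End Correctness.

Theorem theorem13 (R : realType) :
  (forall (P : set 'rV[R]_2) (v : seq 'rV[int]_2) (es : seq (nat * 'rV[int]_2)),
     integral_polygon P v -> edge_sequence v es ->
     ((polydecomp (nth 0%R v 0) es).2 = Decomposable <-> decomposable P) /\
     ((polydecomp (nth 0%R v 0) es).2 = Indecomposable <-> ~ decomposable P)) /\
  (exists C : nat,
   forall (P : set 'rV[R]_2) (v : seq 'rV[int]_2) (es : seq (nat * 'rV[int]_2)),
     integral_polygon P v -> edge_sequence v es ->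
     let t := nb_integral_points P in
     let m := size es in
     let N := max_edge_points R v in
     (polydecomp (nth 0%R v 0) es).1 <= C * (t * m * N)).
Proof.
have v0E (v : seq 'rV[int]_2) : nth 0%R v 0 = cyc v 0 by rewrite /cyc mod0n.
split=> [P v es polyP edgesP|]; rewrite ?v0E; last first.
  exists 12 => P v es polyP edgesP; rewrite v0E (size_edges edgesP).
  exact: polydecomp_cost.
have := polydecomp_correct polyP edgesP.
(* With only two possible answers, the second equivalence is the negation of the first. *)
by case: (polydecomp _ _).2 => -[dec nodec]; do 2 split=> //; [move=> _ /nodec|case; exact: dec].
Qed.
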